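(* Let $d$ and $t_n$ be integers with $t_n\ge d+3$, and let $G_n$ be a $d$-regular, $d$-connected graph on $t_n$ vertices with $\kappa_3(G_n)=d-1$. Let $H_n=G_n^1\oplus G_n^2\oplus\cdots\oplus G_n^{t_n}$ be as described in the context. Then $\kappa_3(H_n)=d$.
   Context: All graphs are simple. $\kappa(G)$ denotes the (vertex) connectivity of $G$. For $S\subseteq V(G)$, an $S$-tree is a tree $T$ in $G$ with $S\subseteq V(T)$; trees $T_1,\dots,T_r$ are internally edge disjoint $S$-trees if $V(T_i)\cap V(T_j)=S$ and $E(T_i)\cap E(T_j)=\emptyset$ for all $i\ne j$. $\kappa_G(S)$ is the maximum number of internally edge disjoint $S$-trees in $G$, and for $2\le k\le |V(G)|$, the generalized $k$-connectivity is $\kappa_k(G)=\min\{\kappa_G(S): S\subseteq V(G),|S|=k\}$. Construction of $H_n$: take $t_n$ disjoint copies $G_n^1,\dots,G_n^{t_n}$ of $G_n$ (called clusters) and add $\frac12 t_n^2$ edges so that the resulting graph $H_n$ is $(d+1)$-regular and (1) every vertex $x$ of a cluster $G_n^i$ has exactly one neighbour outside $G_n^i$ (its out-neighbour $\hat x$); (2) for all $1\le i\ne j\le t_n$ there are one or two edges between $G_n^i$ and $G_n^j$. *)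

(* Defs.v *)
From mathcomp Require Import all_boot.

Set Implicit Arguments.
Unset Strict Implicit.
Unset Printing Implicit Defensive.

Definition simple_graph (T : finType) (e : rel T) : Prop :=
  symmetric e /\ irreflexive e.

Definition regular (T : finType) (e : rel T) (d : nat) : Prop :=
  forall x : T, #|[set y | e x y]| = d.

Definition edges (T : finType) (e : rel T) : {set {set T}} :=
  [set [set p.1; p.2] | p : T * T & e p.1 p.2].

Definition connected (T : finType) (V : {set T}) (e : rel T) : bool :=
  [forall x in V, forall y in V,
     connect [rel u v | [&& u \in V, v \in V & e u v]] x y].

(* With the usual convention for complete graphs: deleting all vertices but
   one counts as a cut, so that the connectivity of K_n is n - 1.  The neutral
   element #|T| bounds all the values #|X|, hence does not affect the minimum. *)
Definition connectivity (T : finType) (e : rel T) : nat :=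
  \big[minn/#|T|]_(X : {set T} | ~~ connected (~: X) e || (#|~: X| <= 1)) #|X|.

Definition k_connected (T : finType) (e : rel T) (k : nat) : Prop :=
  k <= connectivity e.

(* A cycle has pairwise distinct vertices, hence length at most #|T|: see
   acyclicP for the unbounded form. *)
Definition acyclic (T : finType) (e : rel T) : bool :=
  [forall n : 'I_#|T|.+1, forall c : n.-tuple T,
     (2 < n) ==> ~~ ucycleb e c].

Lemma acyclicP (T : finType) (e : rel T) :
  reflect (forall c : seq T, 2 < size c -> ~ ucycle e c) (acyclic e).
Proof.
apply: (iffP forallP) => [H c c_gt2 c_cyc | H n].
  have c_le : size c < #|T|.+1.
    by have /andP[_ /card_uniqP <-] := c_cyc; rewrite ltnS max_card.
  have /forallP/(_ (in_tuple c))/implyP/(_ c_gt2)/negP := H (Ordinal c_le).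
  exact.
apply/forallP => c; apply/implyP => n_gt2; apply/negP.
by apply: H; rewrite size_tuple.
Qed.

(* A pair (vertex set, edge set). *)
Definition subgraph (T : finType) : finType :=
  ({set T} * {set {set T}})%type.

Definition is_subgraph (T : finType) (e : rel T) (A : subgraph T) : bool :=
  (A.2 \subset edges e) && [forall f in A.2, f \subset A.1].

Definition adj (T : finType) (A : subgraph T) : rel T :=
  [rel x y | [set x; y] \in A.2].

Definition is_tree (T : finType) (A : subgraph T) : bool :=
  [&& A.1 != set0, connected A.1 (adj A) & acyclic (adj A)].

Definition S_tree (T : finType) (e : rel T) (S : {set T}) (A : subgraph T) :
    bool :=
  [&& is_subgraph e A, is_tree A & S \subset A.1].

(* For 2 <= #|S| every S-tree has an edge, so edge-disjoint S-trees are
   distinct and a family of them may be given as a set. *)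
Definition internally_disjoint_S_trees (T : finType) (e : rel T) (S : {set T})
    (F : {set (subgraph T)}) : bool :=
  [forall A in F, S_tree e S A] &&
  [forall A in F, forall B in F, (A != B) ==>
     (A.1 :&: B.1 == S) && (A.2 :&: B.2 == set0)].

Definition tree_connectivity (T : finType) (e : rel T) (S : {set T}) : nat :=
  \max_(F : {set (subgraph T)} | internally_disjoint_S_trees e S F) #|F|.

(* Meaningful for 2 <= k <= #|T|; taking the maximum of the values as neutral
   element makes this their minimum, see gen_connectivityP. *)
Definition gen_connectivity (T : finType) (k : nat) (e : rel T) : nat :=
  let m := \max_(S : {set T} | #|S| == k) tree_connectivity e S in
  \big[minn/m]_(S : {set T} | #|S| == k) tree_connectivity e S.

Lemma gen_connectivityP (T : finType) (k : nat) (e : rel T) :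
  k <= #|T| ->
  (exists2 S : {set T}, #|S| = k & gen_connectivity k e = tree_connectivity e S)
  /\ (forall S : {set T}, #|S| = k ->
        gen_connectivity k e <= tree_connectivity e S).
Proof.
move=> k_le; rewrite /gen_connectivity; split; last first.
  move=> S /eqP cS; move: (\max_(_ | _) _) (mem_index_enum S) => m.
  elim: (index_enum _) => //= S1 r IHr; rewrite inE big_cons.
  case/predU1P => [<- | /IHr le_r]; first by rewrite cS geq_minl.
  by case: ifP => // _; rewrite geq_min le_r orbT.
have [S0 cS0] : exists S0 : {set T}, #|S0| == k.
  exists [set:: take k (enum T)].
  have /card_uniqP u : uniq (take k (enum T)) by rewrite take_uniq ?enum_uniq.
  by rewrite cardsE u size_takel // -cardE.
apply: (big_ind (fun m => exists2 S : {set T}, #|S| = k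
                          & m = tree_connectivity e S)).
- have [|S cS ->] := @eq_bigmax_cond _ [pred S : {set T} | #|S| == k]
    (tree_connectivity e); first by apply/card_gt0P; exists S0.
  by exists S => //; apply/eqP.
- by move=> m n Hm Hn; rewrite /minn; case: ifP.
- by move=> S /eqP cS; exists S.
Qed.

(* The edges joining different clusters {i} * T of a graph on 'I_t * T. *)
Definition cross (t : nat) (T : finType) (h : rel ('I_t * T)) :
    rel ('I_t * T) :=
  [rel u v | h u v && (u.1 != v.1)].

(* The vertex (i, x) is the copy of x in the i-th cluster.  The graph h is not
   determined by g: it ranges over all graphs obtained by the construction. *)
Record cluster_sum (d t : nat) (T : finType) (g : rel T)
    (h : rel ('I_t * T)) : Prop := ClusterSum {
  cluster_sum_simple : simple_graph h;
  cluster_sum_copy : forall (i : 'I_t) (x y : T), h (i, x) (i, y) = g x y;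
  cluster_sum_added : 2 * #|edges (cross h)| = t ^ 2;
  cluster_sum_regular : regular h d.+1;
  cluster_sum_out : forall u, #|[set v | cross h u v]| = 1;
  cluster_sum_between : forall i j : 'I_t, i != j ->
    1 <= #|[set p : T * T | h (i, p.1) (j, p.2)]| <= 2
}.

(* Main.v *)
Require Import Defs.
From mathcomp Require Import all_boot.

Set Implicit Arguments.
Unset Strict Implicit.
Unset Printing Implicit Defensive.

(* Two adjacent vertices x, y of degree d + 1 and a third vertex z are not joined
   by d + 1 internally disjoint trees: one of them would use the edge xy, and no
   other edge at x or at y, hence would miss z.

   Conversely let S have three vertices.  If they lie in one cluster, take d - 1
   trees of that cluster, and one more tree through the out-neighbours of S and
   the other clusters.  If they lie in three clusters, choose d further clusters
   as hubs, and in each of the three clusters a fan from the vertex of S to d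
   vertices having their out-neighbours in the hubs.  If x and y lie in one
   cluster and z in another, take d internally disjoint paths from x to y and on
   them d vertices whose out-neighbours lie in distinct clusters; these are the
   hubs to which a fan from z leads.  Paths and fans come from Menger's theorem.
   It is enough to produce connected subgraphs, since these have spanning trees. *)

(** * Menger's theorem *)

(** Relations are read as directed, since Menger's theorem is proved by deleting one arc at a time.
    The empty walk counts, so a separator contains [A :&: B]. *)
Definition separates (T : finType) (e : rel T) (A B X : {set T}) : Prop :=
  forall a p, a \in A -> path e a p -> last a p \in B ->
    exists2 v, v \in a :: p & v \in X.

Definition separatesb (T : finType) (e : rel T) (A B X : {set T}) : bool :=
  [forall a in A, forall b in B, (a \notin X) ==>
    ~~ connect [rel u v | e u v && (v \notin X)] a b].

Lemma separatesP (T : finType) (e : rel T) (A B X : {set T}) :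
  reflect (separates e A B X) (separatesb e A B X).
Proof.
apply: (iffP forall_inP) => [sep a p aA pe lB | sep a aA].
  apply/hasP; apply/negPn/negP => /hasPn nX.
  have /forall_inP/(_ _ lB)/implyP/(_ (nX a (mem_head _ _)))/negP := sep a aA.
  apply; apply/connectP; exists p => //.
  have {nX}: {in p, forall v, v \notin X}.
    by move=> v vp; apply: nX; rewrite inE vp orbT.
  elim: p a pe {aA lB} => //= b p IHp a /andP[-> pb] nX.
  by rewrite nX ?mem_head //= IHp // => v vp; rewrite nX // inE vp orbT.
apply/forall_inP => b bB; apply/implyP => aX; apply/negP => /connectP[p pe Eb].
have p1 : path e a p by apply: sub_path pe => u v /andP[].
have [|v vp vX] := sep a p aA p1; first by rewrite -Eb.
move: vp; rewrite inE => /predU1P[E|vp]; first by rewrite -E vX in aX.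
elim: p a pe vp {aA Eb aX p1} => //= c p IHp a /andP[/andP[_ cX] pc].
by rewrite inE => /predU1P[E|/(IHp c pc)//]; rewrite -E vX in cX.
Qed.

Definition linked (T : finType) (e : rel T) (A B : {set T}) (k : nat) : Prop :=
  exists (s : 'I_k -> T) (p : 'I_k -> seq T),
    [/\ forall i, s i \in A, forall i, path e (s i) (p i),
        forall i, last (s i) (p i) \in B &
        forall i j v, v \in s i :: p i -> v \in s j :: p j -> i = j].

Definition remove_arc (T : finType) (e : rel T) (x y : T) : rel T :=
  [rel u v | e u v && ~~ ((u == x) && (v == y))].

Lemma path_remove_source (T : finType) (e : rel T) (x y a : T) (p : seq T) :
  path e a p -> x \notin belast a p -> path (remove_arc e x y) a p.
Proof.
elim: p a => //= b p IHp a /andP[eab pb]; rewrite inE negb_or eq_sym.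
by case/andP=> ax xp; rewrite /remove_arc /= eab (negPf ax) IHp.
Qed.

Lemma path_remove_target (T : finType) (e : rel T) (x y a : T) (p : seq T) :
  path e a p -> y \notin p -> path (remove_arc e x y) a p.
Proof.
elim: p a => //= b p IHp a /andP[eab pb]; rewrite inE negb_or eq_sym.
by case/andP=> ax xp; rewrite /remove_arc /= eab (negPf ax) andbF IHp.
Qed.

Lemma linked_uniq (T : finType) (e : rel T) (A B : {set T}) (k : nat) :
  linked e A B k ->
  exists (s : 'I_k -> T) (p : 'I_k -> seq T),
    [/\ forall i, s i \in A, forall i, path e (s i) (p i),
        forall i, last (s i) (p i) \in B, forall i, uniq (s i :: p i) &
        forall i j v, v \in s i :: p i -> v \in s j :: p j -> i = j].
Proof.
case=> s [p [sA pe lB dis]]; exists s, (fun i => shorten (s i) (p i)).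
have sh i : [/\ path e (s i) (shorten (s i) (p i)),
    last (s i) (shorten (s i) (p i)) = last (s i) (p i),
    uniq (s i :: shorten (s i) (p i)) &
    {subset s i :: shorten (s i) (p i) <= s i :: p i}].
  case/shortenP: (pe i) => q pq uq sq; split=> // v.
  by rewrite !inE => /predU1P[->|/sq ->]; rewrite ?eqxx ?orbT.
split=> // [i|i|i|i j v vi vj]; first by case: (sh i).
- by case: (sh i) => _ ->.
- by case: (sh i).
by apply: (dis i j v); [case: (sh i) | case: (sh j)] => _ _ _; apply.
Qed.

(** Every walk of [e] from [A] to [B] meets [x |: S]: if it avoids [x], it cannot use the arc
    [(x, y)], and then it meets [S]. Its part up to the first such vertex never leaves [x], so it
    survives the deletion of the arc and meets [X]. *)
Lemma separates_source (T : finType) (e : rel T) (A B S X : {set T}) (x y : T) :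
  separates (remove_arc e x y) A B S ->
  separates (remove_arc e x y) A (x |: S) X -> separates e A B X.
Proof.
move=> sepS sepX a p aA pe lB.
have [v vp vP] : exists2 v, v \in a :: p & v \in x |: S.
  case: (boolP (x \in a :: p)) => [xp|xp]; first by exists x; rewrite ?setU11.
  have xb : x \notin belast a p by apply: contra xp; apply: mem_belast.
  have [v vp vS] := sepS a p aA (path_remove_source y pe xb) lB.
  by exists v => //; rewrite inE vS orbT.
(* Induction from the right end cuts the walk down to its first vertex in [x |: S]. *)
elim/last_ind: p {lB} pe v vp vP => [|p b IHp] pe v vp vP.
  apply: (sepX a [::]) => //=; move: vp; rewrite inE => /eqP <-; exact: vP.
move: pe; rewrite rcons_path => /andP[pe eb].
have [/hasP[w wp wP]|/hasPn nP] := boolP (has (mem (x |: S)) (a :: p)).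
  have [u up uX] := IHp pe w wp wP; exists u => //.
  by rewrite -rcons_cons mem_rcons inE up orbT.
have {vp} vb : v = b.
  apply/eqP; move: vp; rewrite -rcons_cons mem_rcons inE => /predU1P[->//|vp].
  by have := nP v vp; rewrite /= vP.
apply: sepX => //; last by rewrite last_rcons -vb.
apply: path_remove_source; first by rewrite rcons_path pe.
rewrite belast_rcons; apply/negP => /nP /=.
by rewrite setU11.
Qed.

(** Mirror image of [separates_source]: from its last vertex in [y |: S] on, the walk does not enter
    [y] again. *)
Lemma separates_target (T : finType) (e : rel T) (A B S X : {set T}) (x y : T) :
  separates (remove_arc e x y) A B S ->
  separates (remove_arc e x y) (y |: S) B X -> separates e A B X.
Proof.
move=> sepS sepX a p aA pe lB.
have : has (mem (y |: S)) (a :: p).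
  case: (boolP (y \in p)) => [xp|xp].
    by apply/hasP; exists y; rewrite ?inE ?xp ?orbT ?eqxx.
  have [v vp vS] := sepS a p aA (path_remove_target x pe xp) lB.
  by apply/hasP; exists v => //; rewrite !inE vS orbT.
elim: p a {aA} pe lB => [|b p IHp] a pe lB.
  rewrite /= orbF => aQ; exact: (sepX a [::]).
have /= /andP[eab pb] := pe; rewrite /= -/(has _ (b :: p)).
have [hb _|hb] := boolP (has (mem (y |: S)) (b :: p)).
  have [u up uX] := IHp b pb lB hb; exists u => //.
  by rewrite inE up orbT.
rewrite orbF => aQ; apply: sepX => //; apply: path_remove_target => //.
by apply: contra hb => yp; apply/hasP; exists y => //=; rewrite setU11.
Qed.

Lemma injective_onto (T : finType) (k : nat) (f : 'I_k -> T) (P : {set T}) :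
  injective f -> (forall i, f i \in P) -> #|P| <= k ->
  forall v, v \in P -> exists i, v = f i.
Proof.
move=> finj fP cP v vP.
have /eqP E : f @: 'I_k == P.
  rewrite eqEcard card_imset // card_ord cP andbT.
  by apply/subsetP => _ /imsetP[i _ ->].
by move: vP; rewrite -E => /imsetP[i _ ->]; exists i.
Qed.

(* Goering's induction: if deleting the arc (x, y) creates a separator S with
   fewer than k vertices, then S + x and S + y have k vertices, and the k paths
   from A to S + x and from S + y to B found by induction can be spliced. *)
Theorem menger (T : finType) (e : rel T) (A B : {set T}) (k : nat) :
  (forall X, separates e A B X -> k <= #|X|) -> linked e A B k.
Proof.
have [n] := ubnP #|[set p : T * T | e p.1 p.2]|.
elim: n e A B => // n IHn e A B; rewrite ltnS => le_n sep.
have [e0|[[x y] exy]] := set_0Vmem [set p : T * T | e p.1 p.2].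
  (* Without arcs all walks are empty, so [A :&: B] separates, and [k] of its vertices are the
     required paths. *)
  have cAB : k <= #|A :&: B|.
    apply: sep => a [|b p] aA /=; first by move=> _ aB; exists a; rewrite ?inE ?eqxx ?aA.
    by case/andP=> eab; have := in_set0 (a, b); rewrite -e0 inE /= eab.
  pose s (i : 'I_k) : T := enum_val (widen_ord cAB i).
  have sP i : s i \in A :&: B by apply: enum_valP.
  exists s, (fun _ => [::]); split=> // [i|i|i j v].
  - by case/setIP: (sP i).
  - by case/setIP: (sP i).
  rewrite !inE => /eqP-> /eqP/enum_val_inj E; apply: val_inj.
  by have := congr1 val E.
set e' := remove_arc e x y.
have lt_e' : #|[set p : T * T | e' p.1 p.2]| < n.
  apply: leq_trans le_n; apply: proper_card; apply/properP; split.
    by apply/subsetP => u; rewrite !inE => /andP[].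
  by exists (x, y) => //; rewrite inE /e' /remove_arc /= !eqxx andbF.
have mono C D : linked e' C D k -> linked e C D k.
  case=> s [p [? pe ? ?]]; exists s, p; split=> // i.
  by apply: sub_path (pe i) => u v /andP[].

have [/existsP[S /andP[ltS /separatesP sepS]]|nS] :=
  boolP [exists S : {set T}, (#|S| < k) && separatesb e' A B S]; last first.
  apply/mono/IHn => // X sepX; rewrite leqNgt; apply/negP => ltX.
  by case/existsP: nS; exists X; rewrite ltX; apply/separatesP.
have /linked_uniq[s1 [p1 [s1A pe1 l1P u1 dis1]]] : linked e' A (x |: S) k.
  by apply: IHn => // X sepX; apply: sep; apply: separates_source sepS sepX.
have /linked_uniq[s2 [p2 [s2Q pe2 l2B u2 dis2]]] : linked e' (y |: S) B k.
  by apply: IHn => // X sepX; apply: sep; apply: separates_target sepS sepX.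
have card1 z : #|z |: S| <= k.
  by rewrite cardsU1; apply: leq_trans ltS; rewrite -add1n leq_add2r leq_b1.
have onto1 : forall v, v \in x |: S -> exists i, v = last (s1 i) (p1 i).
  apply: injective_onto => // i j E.
  by apply: (dis1 i j (last (s1 i) (p1 i))); [|rewrite E]; apply: mem_last.
have onto2 : forall v, v \in y |: S -> exists i, v = s2 i.
  apply: injective_onto => // i j E.
  by apply: (dis2 i j (s2 i)); [|rewrite E]; apply: mem_head.
(* Otherwise the [k] distinct starting points [s2 i] would all lie in [S], which has fewer than [k]
   vertices. *)
have yS : y \notin S.
  apply/negP => yS; suff : k <= #|S| by rewrite leqNgt ltS.
  have <- : y |: S = S by apply/setUidPr; rewrite sub1set.
  rewrite -[k]card_ord.
  rewrite -(@card_imset _ _ s2); last first.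
    by move=> i j E; apply: (dis2 i j (s2 i)); [|rewrite E]; apply: mem_head.
  by apply/subset_leq_card/subsetP => _ /imsetP[i _ ->].
(* If [v] were outside [S], following the first path to [v] and the second one from [v] would give a
   walk without the arc [(x, y)], which must meet [S]. But the first path meets [x |: S] only at its
   end, and the second meets [y |: S] only at its start; neither point belongs to the piece in
   use. *)
have meet i j v : v \in s1 i :: p1 i -> v \in s2 j :: p2 j -> v \in S.
  move=> v1 v2; apply/negPn/negP => vS.
  have onlyP u : u \in s1 i :: p1 i -> u \in x |: S -> u = last (s1 i) (p1 i).
    move=> ui uP; have [i' E] := onto1 u uP.
    have -> : i = i' by apply: (dis1 i i' u) => //; rewrite E mem_last.
    exact: E.
  have onlyQ u : u \in s2 j :: p2 j -> u \in y |: S -> u = s2 j.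
    move=> uj uQ; have [j' E] := onto2 u uQ.
    have -> : j = j' by apply: (dis2 j j' u) => //; rewrite E mem_head.
    exact: E.
  move: (pe1 i) (u1 i) (l1P i) onlyP; case/splitPl: v1 => q r lq.
  rewrite cat_path last_cat lq -cat_cons cat_uniq => /andP[q1 _] /and3P[_ nqr _] lP onlyP.
  move: (pe2 j) (u2 j) (l2B j) onlyQ; case/splitPl: v2 => q' r' lq'.
  rewrite cat_path last_cat lq' => /andP[_ r'2] uq' lB onlyQ.
  have [||w] := sepS (s1 i) (q ++ r') (s1A i).
  - by rewrite cat_path q1 lq.
  - by rewrite last_cat lq.
  rewrite -cat_cons mem_cat => /orP[wq|wr'] wS.
    have wP : w \in x |: S by rewrite inE wS orbT.
    have E := onlyP w; rewrite mem_cat wq in E; have {}E := E isT wP.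
    case: r nqr lP E {onlyP} => [|c r] nqr lP E; first by rewrite -(E : w = v) wS in vS.
    by case/hasP: nqr; exists w => //; rewrite E /= mem_last.
  have wQ : w \in y |: S by rewrite inE wS orbT.
  have E := onlyQ w; rewrite -cat_cons mem_cat wr' orbT in E; have {}E := E isT wQ.
  move: uq'; rewrite -cat_cons cat_uniq => /and3P[_ /hasP[]].
  by exists w => //; rewrite E mem_head.
(* A path ending in [x] goes on over the arc to [y]; any other one ends in [S] and goes on from the
   same vertex. *)
pose l i := last (s1 i) (p1 i); pose phi v := if v == x then y else v.
have phiQ i : phi (l i) \in y |: S.
  rewrite /phi; case: eqVneq => [_|nx]; first exact: setU11.
  by have := l1P i; rewrite !inE (negPf nx) /= => ->; rewrite orbT.
have /fin_all_exists[sg sgE] : forall i, exists j, phi (l i) = s2 j.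
  by move=> i; apply/onto2/phiQ.
have linj i j : l i = l j -> i = j.
  by move=> E; apply: (dis1 i j (l i)); [|rewrite E]; apply: mem_last.
have phi_inj i j : phi (l i) = phi (l j) -> i = j.
  move=> E; apply: linj; move: E (l1P i) (l1P j); rewrite -/(l i) -/(l j) /phi !inE.
  case: eqP => [->|_]; case: eqP => [->|_] //= E; first by rewrite -E (negPf yS).
  by rewrite E (negPf yS).
(* A vertex common to the two systems lies in [S], where it is the end of a first path and the start
   of a second one; hence these two are matched. *)
have cross12 i j v : v \in s1 i :: p1 i -> v \in s2 (sg j) :: p2 (sg j) -> i = j.
  move=> vi vj; have vS := meet _ _ _ vi vj.
  have [i' Ei] : exists i', v = l i' by apply: onto1; rewrite inE vS orbT.
  have [j' Ej] : exists j', v = s2 j' by apply: onto2; rewrite inE vS orbT.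
  have -> : i = i' by apply: (dis1 i i' v) => //; rewrite Ei mem_last.
  have E : sg j = j' by apply: (dis2 _ _ v) => //; rewrite Ej mem_head.
  apply: phi_inj; rewrite (sgE j) E -Ej -Ei /phi.
  case: eqP => // vx; move: (sgE j); rewrite E -Ej /phi.
  by case: (l j =P x) => // nx lv; case: nx; rewrite lv.
exists s1, (fun i => p1 i ++ if l i == x then s2 (sg i) :: p2 (sg i)
                             else p2 (sg i)).
have sgl i : l i != x -> s2 (sg i) = l i.
  by move=> nx; rewrite -sgE /phi (negPf nx).
have in12 i v : v \in s1 i :: (p1 i ++ if l i == x then s2 (sg i) :: p2 (sg i)
                             else p2 (sg i)) ->
    v \in s1 i :: p1 i \/ v \in s2 (sg i) :: p2 (sg i).
  rewrite -cat_cons mem_cat => /orP[]; first by left.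
  by case: ifP => _ vi; right=> //; rewrite inE vi orbT.
split=> // [i|i|i j v].
- rewrite cat_path -/(l i); apply/andP; split.
    by apply: sub_path (pe1 i) => u v /andP[].
  have p2e : path e (s2 (sg i)) (p2 (sg i)).
    by apply: sub_path (pe2 (sg i)) => u v /andP[].
  case: eqVneq => [lx|/sgl <- //]; rewrite /= p2e andbT lx.
  by rewrite -sgE /phi lx eqxx; rewrite inE in exy.
- rewrite last_cat -/(l i); case: eqVneq => [_|/sgl <- //]; exact: l2B.
case/in12=> vi /in12[vj|vj].
- exact: dis1 vi vj.
- exact: cross12 vi vj.
- by apply/esym; apply: cross12 vj vi.
by apply: phi_inj; rewrite !sgE (dis2 _ _ _ vi vj).
Qed.

(** * Connected subgraphs, fans and paths *)

Definition within (T : finType) (V : {set T}) (e : rel T) : rel T :=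
  [rel u v | [&& u \in V, v \in V & e u v]].

Lemma connectedP (T : finType) (V : {set T}) (e : rel T) :
  reflect {in V &, forall x y, connect (within V e) x y} (connected V e).
Proof.
apply: (iffP forall_inP) => [H x y xV yV | H x xV].
  by have /forall_inP/(_ y yV) := H x xV.
by apply/forall_inP => y yV; apply: H.
Qed.

Lemma connect_within_sub (T : finType) (V W : {set T}) (e e' : rel T) (x y : T) :
  V \subset W -> {in V &, subrel e e'} ->
  connect (within V e) x y -> connect (within W e') x y.
Proof.
move=> sVW se; apply: connect_sub => u v /and3P[uV vV euv].
by apply: connect1; rewrite /within /= !(subsetP sVW) // se.
Qed.

Lemma within_sym (T : finType) (V : {set T}) (e : rel T) :
  symmetric e -> symmetric (within V e).
Proof. by move=> sym u v; rewrite /within /= sym andbCA. Qed.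

Lemma connected_from (T : finType) (V : {set T}) (e : rel T) (x : T) :
  symmetric e -> {in V, forall y, connect (within V e) x y} -> connected V e.
Proof.
move=> sym H; apply/connectedP => y z yV zV.
apply: connect_trans (H z zV); rewrite (sym_connect_sym (within_sym V sym)).
exact: H.
Qed.

Lemma connected1 (T : finType) (x : T) (e : rel T) : connected [set x] e.
Proof. by apply/connectedP => u v /set1P-> /set1P->. Qed.

Lemma connected_subrel (T : finType) (V : {set T}) (e e' : rel T) :
  {in V &, subrel e e'} -> connected V e -> connected V e'.
Proof.
move=> se /connectedP H; apply/connectedP => x y xV yV.
exact: connect_within_sub (H x y xV yV).
Qed.

Lemma connectedU (T : finType) (V W : {set T}) (e : rel T) (x y : T) :
  symmetric e -> connected V e -> connected W e ->
  x \in V -> y \in W -> (x == y) || e x y -> connected (V :|: W) e.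
Proof.
move=> sym /connectedP cV /connectedP cW xV yW exy.
apply: (connected_from (x := x)) => // z; rewrite inE => /orP[zV|zW].
  by apply: connect_within_sub (cV x z xV zV); rewrite ?subsetUl.
apply: (@connect_trans _ _ y).
  case/orP: exy => [/eqP-> //|exy].
  by apply: connect1; rewrite /within /= !inE xV yW orbT.
by apply: connect_within_sub (cW y z yW zW); rewrite ?subsetUr.
Qed.

Lemma connected_path (T : finType) (e : rel T) (x : T) (p : seq T) :
  symmetric e -> path e x p -> connected [set v in x :: p] e.
Proof.
move=> sym; elim: p x => [|y p IHp] x /=.
  by rewrite set_cons set_nil setU0 connected1.
case/andP=> exy py; rewrite set_cons.
by apply: (@connectedU _ _ _ _ x y); rewrite ?connected1 ?IHp ?inE ?eqxx ?exy ?orbT.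
Qed.

Lemma connected_imset (T U : finType) (f : T -> U) (V : {set T})
    (e : rel T) (e' : rel U) :
  {in V &, forall x y, e x y -> e' (f x) (f y)} ->
  connected V e -> connected (f @: V) e'.
Proof.
move=> fe /connectedP cV.
apply/connectedP => _ _ /imsetP[x xV ->] /imsetP[y yV ->].
have /connectP[p pe ->] := cV x y xV yV; elim: p x {xV} pe => [|z p IHp] x /=.
  by [].
case/andP=> /and3P[xV zV exz] pz; apply: connect_trans (IHp z pz).
by apply: connect1; rewrite /within /= !imset_f // fe.
Qed.

Lemma k_connected_setC (T : finType) (e : rel T) (k : nat) (X : {set T}) :
  k_connected e k -> #|X| < k -> connected (~: X) e.
Proof.
rewrite /k_connected /connectivity => ke ltX; apply/negPn/negP => nX.
move: ke; rewrite leqNgt => /negP[]; apply: leq_ltn_trans ltX.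
move: (#|T|) (mem_index_enum X) => m.
elim: (index_enum _) => //= Y r IHr; rewrite inE big_cons.
case/predU1P => [<- | /IHr le_r]; first by rewrite nX geq_minl.
by case: ifP => // _; rewrite geq_min le_r orbT.
Qed.

Lemma set_exists_notin (T : finType) (A X : {set T}) :
  #|X| < #|A| -> exists2 a, a \in A & a \notin X.
Proof.
move=> lt; apply/exists_inP; apply: contraLR lt.
rewrite negb_exists_in -leqNgt => /forall_inP AX; apply/subset_leq_card.
by apply/subsetP => a /AX/negPn.
Qed.

(* No separator X has fewer than m vertices, because e is connected outside
   X :|: Y. *)
Lemma linked_k_connected (T : finType) (e r : rel T) (A B : {set T}) (k m : nat)
    (Y : {set T}) :
  k_connected e k -> m + #|Y| <= k -> #|A| = m -> #|B| = m ->
  [disjoint A & Y] -> [disjoint B & Y] ->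
  (forall u v, u \notin Y -> v \notin Y -> e u v -> r u v) -> linked r A B m.
Proof.
move=> ke lemk cA cB dAY dBY er; apply: menger => X sepX.
rewrite leqNgt; apply/negP => ltX.
have [|a aA aX] := @set_exists_notin _ A X; first by rewrite cA.
have [|b bB bX] := @set_exists_notin _ B X; first by rewrite cB.
have aY := disjointFr dAY aA; have bY := disjointFr dBY bB.
have /connectedP cXY : connected (~: (X :|: Y)) e.
  apply: (k_connected_setC ke); apply: leq_ltn_trans (leq_card_setU X Y) _.
  by apply: leq_trans lemk; rewrite ltn_add2r.
have /connectP[p pe Eb] : connect (within (~: (X :|: Y)) e) a b.
  by apply: cXY; rewrite !inE negb_or ?aX ?aY ?bX ?bY.
have pr : path r a p.
  apply: sub_path pe => u v /and3P[]; rewrite !inE !negb_or.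
  by case/andP=> _ uY /andP[_ vY] /er->.
have [|v vp vX] := sepX a p aA pr; first by rewrite -Eb.
move: vp; rewrite inE => /predU1P[E|vp]; first by rewrite -E vX in aX.
elim: p a pe vp {aA aX aY Eb pr} => //= c p IHp a /andP[/and3P[_ cX _] pc].
rewrite inE => /predU1P[E|/(IHp c pc)//].
by move: cX; rewrite -E !inE vX.
Qed.

(** Menger's theorem between the [d] neighbours of [z] and the [d] targets, with [z] added to each
    path. The vertex [z] may be a target or lie on one of the paths; this is harmless, as the
    branches may share [z] anyway. *)
Lemma k_connected_fan (T : finType) (e : rel T) (d : nat) (z : T) (w : 'I_d -> T) :
  simple_graph e -> regular e d -> k_connected e d -> injective w ->
  exists Z : 'I_d -> {set T},
    [/\ forall k, z \in Z k, forall k, w k \in Z k,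
        forall k, connected (Z k) e &
        forall k l, k != l -> Z k :&: Z l \subset [set z]].
Proof.
move=> [sym irr] reg ke winj.
have [s [p [sN pe lw dis]]] : linked e [set y | e z y] (w @: 'I_d) d.
  apply: (linked_k_connected (Y := set0) ke) => //.
  - by rewrite cards0 addn0.
  - by rewrite card_imset // card_ord.
  - by rewrite -setI_eq0 setI0.
  - by rewrite -setI_eq0 setI0.
(* The [d] distinct path ends exhaust the [d] targets, so the paths can be renumbered by their
   targets. *)
have /fin_all_exists[sg sgE] : forall k, exists i, w k = last (s i) (p i).
  move=> k; apply: (injective_onto (P := w @: 'I_d)) => //.
  - by move=> i j E; apply: (dis i j (last (s i) (p i))); [|rewrite E]; apply: mem_last.
  - by rewrite card_imset ?card_ord.
  - exact: imset_f.
exists (fun k => z |: [set v in s (sg k) :: p (sg k)]); split=> [k|k|k|k l nkl].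
- exact: setU11.
- by rewrite !inE sgE -in_cons mem_last orbT.
- apply: (@connectedU _ _ _ _ z (s (sg k))); rewrite ?connected1 ?connected_path //.
  + exact: set11.
  + by rewrite !inE eqxx.
  + by have := sN (sg k); rewrite inE => ->; rewrite orbT.
apply/subsetP => v /setIP[]; rewrite !in_setU !in_set1 => /predU1P[-> //|vk] /predU1P[-> //|].
rewrite inE in vk; rewrite inE => vl; case/negP: nkl; apply/eqP/winj.
by rewrite !sgE (dis _ _ _ vk vl).
Qed.

Lemma linked_paths (T : finType) (r : rel T) (x y : T) (m : nat) :
  symmetric r -> linked r [set v | r x v] [set v | r y v] m ->
  exists W : 'I_m -> {set T},
    [/\ forall k, x \in W k, forall k, y \in W k, forall k, connected (W k) r &
        forall k l, k != l -> W k :&: W l \subset [set x; y]].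
Proof.
move=> sym [s [p [sN pr lN dis]]].
exists (fun k => [set x] :|: [set v in s k :: p k] :|: [set y]).
split=> [k|k|k|k l nkl].
- by rewrite !inE eqxx.
- by rewrite !inE eqxx !orbT.
- apply: (@connectedU _ _ _ _ (last (s k) (p k)) y); rewrite ?connected1 ?set11 //.
  + apply: (@connectedU _ _ _ _ x (s k)); rewrite ?connected1 ?set11 ?connected_path //.
      by rewrite !inE eqxx.
    by have := sN k; rewrite inE => ->; rewrite orbT.
  + by apply/setUP; right; rewrite inE mem_last.
  + by have := lN k; rewrite inE sym => ->; rewrite orbT.
apply/subsetP => v /setIP[/setUP[/setUP[]|]].
- by rewrite !inE => ->.
- rewrite inE => vk /setUP[/setUP[]|]; try by rewrite !inE => ->; rewrite ?orbT.
  by rewrite inE => vl; case/eqP: nkl; apply: dis vk vl.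
by rewrite !inE => ->; rewrite !orbT.
Qed.

(** If [x] and [y] are adjacent, their edge is the path of index [k0], and Menger's theorem gives
    the other [d - 1] between the remaining neighbours. Otherwise it gives all [d], and [k0] is
    arbitrary. Only index [k0] may use an edge inside [[set x; y]], which later keeps the trees edge
    disjoint. *)
Lemma k_connected_paths (T : finType) (e : rel T) (d : nat) (x y : T) :
  simple_graph e -> regular e d -> k_connected e d -> 0 < d -> x != y ->
  exists (W : 'I_d -> {set T}) (k0 : 'I_d),
    [/\ forall k, x \in W k, forall k, y \in W k,
        forall k, connected (W k)
          [rel u v | e u v &&
             ((k == k0) || ~~ ((u \in [set x; y]) && (v \in [set x; y])))] &
        forall k l, k != l -> W k :&: W l \subset [set x; y]].
Proof.
move=> [sym irr] reg ke d_gt0 nxy.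
pose r : rel T := [rel u v | e u v && ~~ ((u \in [set x; y]) && (v \in [set x; y]))].
have rsym : symmetric r by move=> u v; rewrite /r /= sym andbC [X in ~~ X]andbC andbC.
have rx v : r x v = e x v && (v != y).
  rewrite /r /= !inE eqxx /=; case: (v =P x) => [->|]; last by [].
  by rewrite irr.
have ry v : r y v = e y v && (v != x).
  rewrite /r /= !inE eqxx orbT /= orbC; case: (v =P y) => [->|]; last by [].
  by rewrite irr.
have [exy|nexy] := boolP (e x y).
  have [d' Ed] : exists d', d = d'.+1 by exists d.-1; rewrite prednK.
  subst d.
  have cN a b : e a b -> #|[set v | e a v && (v != b)]| = d'.
    move=> eab; have := reg a; rewrite (cardsD1 b) inE eab add1n => -[<-].
    by apply: eq_card => v; rewrite !inE andbC.
  have [|W [Wx Wy cW dW]] := @linked_paths _ r x y d' rsym.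
    (* Excluding the vertex [y] destroys the edge [xy] and costs one unit of connectivity, so [d']
       paths remain. *)
    apply: (@linked_k_connected _ e r _ _ d'.+1 d' [set y]) => //.
    + by rewrite cards1 addn1.
    + by rewrite -(cN x y exy); apply: eq_card => v; rewrite !in_set rx.
    + by rewrite -(cN y x); [apply: eq_card => v; rewrite !in_set ry | rewrite sym].
    + by rewrite disjoint_sym disjoints1 in_set rx eqxx andbF.
    + by rewrite disjoint_sym disjoints1 in_set ry irr.
    move=> u v; rewrite /r /= !inE => /negPf-> /negPf-> euv; rewrite euv !orbF /=.
    by apply/negP => /andP[/eqP E /eqP E']; rewrite E E' irr in euv.
  exists (fun k => if unlift ord0 k is Some j then W j else [set x; y]), ord0.
  split=> [k|k|k|k l].
  - by case: unliftP => // _; rewrite !inE eqxx.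
  - by case: unliftP => // _; rewrite !inE eqxx orbT.
  - case: unliftP => [j ->|->].
      by apply: connected_subrel (cW j) => u v _ _ /andP[/= -> ->]; rewrite ?orbT.
    apply: (@connectedU _ _ _ _ x y); rewrite ?connected1 ?set11 //=.
      by move=> u v /=; rewrite sym.
    by rewrite exy orbT.
  case: unliftP => [j ->|->]; case: unliftP => [j' ->|->] //.
  - by move=> njj; apply: dW; apply: contra njj => /eqP->.
  - by rewrite subsetIr.
  by rewrite subsetIl.
have [|W [Wx Wy cW dW]] := @linked_paths _ r x y d rsym.
  apply: (@linked_k_connected _ e r _ _ d d set0) => //.
  - by rewrite cards0 addn0.
  - rewrite -(reg x); apply: eq_card => v; rewrite !in_set rx.
    by case: (v =P y) => [->|]; rewrite ?(negPf nexy) ?andbT.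
  - rewrite -(reg y); apply: eq_card => v; rewrite !in_set ry.
    by case: (v =P x) => [->|]; rewrite ?[e y x]sym ?(negPf nexy) ?andbT.
  - by rewrite -setI_eq0 setI0.
  - by rewrite -setI_eq0 setI0.
  move=> u v _ _; rewrite /r /= !inE => euv; rewrite euv.
  by apply: contraNN nexy => /andP[/orP[]/eqP E /orP[]/eqP E'];
    move: euv; rewrite E E' ?irr // sym.
exists W, (Ordinal d_gt0); split=> // k.
by apply: connected_subrel (cW k) => u v _ _ /andP[/= -> ->]; rewrite orbT.
Qed.

(** * Packing trees *)

Lemma edges_pair (T : finType) (e : rel T) (x y : T) :
  symmetric e -> ([set x; y] \in edges e) = e x y.
Proof.
move=> sym; apply/imsetP/idP => [[[a b]]|exy]; last first.
  by exists (x, y) => //; rewrite inE.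
rewrite inE /= => eab E.
have : a \in [set x; y] by rewrite E set21.
have : b \in [set x; y] by rewrite E set22.
have : x \in [set a; b] by rewrite -E set21.
have : y \in [set a; b] by rewrite -E set22.
rewrite !inE => /orP[]/eqP-> /orP[]/eqP->; rewrite ?orbb.
- by move=> /eqP Eb _; rewrite -[in X in e _ X]Eb.
- by rewrite sym.
- by [].
by move=> _ /eqP Ea; rewrite -[in X in e X _]Ea.
Qed.

Lemma adj_sym (T : finType) (A : subgraph T) : symmetric (adj A).
Proof. by move=> x y; rewrite /adj /= setUC. Qed.

Lemma connected_leaves (T : finType) (V X : {set T}) (e : rel T) (x y : T) :
  connected V e -> x \in V -> y \in V -> x \in X -> y \notin X ->
  exists u v, [/\ u \in X, v \in V, v \notin X & e u v].
Proof.
move=> /connectedP cV xV yV xX yX; have /connectP[p pe Ey] := cV x y xV yV.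
elim: p x pe Ey {xV} xX => [|z p IHp] x /=; first by move=> _ <-; rewrite (negPf yX).
case/andP=> /and3P[xV zV exz] pz Ey xX.
by have [/(IHp z pz Ey)//|zX] := boolP (z \in X); exists x, z.
Qed.

(** An inclusion-minimal edge set keeping [V] connected has no cycle, because an edge of a cycle can
    be deleted without disconnecting [V]. *)
Lemma spanning_tree (T : finType) (V : {set T}) (E : {set {set T}}) :
  V != set0 -> (forall f, f \in E -> f \subset V) ->
  connected V (adj (V, E)) ->
  exists2 E' : {set {set T}}, E' \subset E & is_tree (V, E').
Proof.
move=> V0 EV cV.
have [E' minE' sE'] :=
  @minset_exists _ (fun E0 : {set {set T}} => connected V (adj (V, E0))) E cV.
exists E' => //; rewrite /is_tree V0; have cE' := minsetp minE'; rewrite /= cE' /=.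
apply/acyclicP => -[|a [|b [|c p]]] // _ /andP[/= /and3P[ab bc cp] /andP[ap /andP[bp cp']]].
have fresh : {in c :: p, forall v, v \notin [set a; b]}.
  move=> v vp; rewrite !inE negb_or; apply/andP; split.
    by apply: contra ap => /eqP <-; rewrite inE vp orbT.
  by apply: contra bp => /eqP <-.
pose E1 := E' :\ [set a; b].
have E1r u v : u \in V -> v \in V -> [set u; v] \in E' ->
    (u \notin [set a; b]) || (v \notin [set a; b]) -> within V (adj (V, E1)) u v.
  move=> uV vV uvE nab; rewrite /within /= uV vV /adj /= !inE uvE andbT /=.
  apply/eqP => E1E; move: nab; rewrite -E1E.
  by rewrite !inE !eqxx orbT.
have E'V u v : [set u; v] \in E' -> (u \in V) && (v \in V).
  by move=> /(subsetP sE')/EV/subsetP H; rewrite !H // !inE eqxx ?orbT.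
(* The rest of the cycle leads from [c] back to [a]. Each of its edges has an end other than [a] and
   [b], so it differs from the deleted edge. *)
have walk u q : path (adj (V, E')) u (rcons q a) ->
    {in u :: q, forall v, v \notin [set a; b]} ->
    connect (within V (adj (V, E1))) u a.
  elim: q u => [|v q IHq] u /=.
    rewrite andbT => ua /(_ u (mem_head _ _)) nu.
    by have /andP[uV aV] := E'V _ _ ua; apply/connect1/E1r; rewrite ?nu.
  case/andP=> uv vq fr; have /andP[uV vV] := E'V _ _ uv.
  apply: (@connect_trans _ _ v); first by apply/connect1/E1r; rewrite ?(fr u (mem_head _ _)).
  by apply: IHq => // w wq; apply: fr; rewrite inE wq orbT.
have ba : connect (within V (adj (V, E1))) b a.
  have /andP[bV cV'] := E'V _ _ bc.
  apply: (@connect_trans _ _ c); last exact: walk fresh.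
  by apply/connect1/E1r; rewrite ?(fresh c) ?mem_head ?orbT.
have cE1 : connected V (adj (V, E1)).
  apply/connectedP => x y xV yV.
  have := connectedP _ _ cE' x y xV yV; apply: connect_sub => u v /and3P[uV vV uv].
  have [n|] := boolP ((u \notin [set a; b]) || (v \notin [set a; b])).
    by apply/connect1/E1r.
  rewrite negb_or !negbK !inE => /andP[/orP[]/eqP-> /orP[]/eqP->] //.
  by rewrite (sym_connect_sym (within_sym V (adj_sym _))).
have E1E : E1 = E' by apply: (minsetinf minE' cE1); apply: subsetDl.
by move: ab; rewrite /adj /= -E1E !inE eqxx.
Qed.

(** Spanning trees of the connected pieces [V i] form the family. A common edge of two of them would
    have both ends in [V i :&: V j], hence in [S], so the relations [r i] have to be disjoint only
    on pairs inside [S]. *)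
Lemma packing (T I : finType) (e : rel T) (S : {set T}) (V : I -> {set T})
    (r : I -> rel T) :
  simple_graph e -> 1 < #|S| ->
  (forall i, S \subset V i) -> (forall i, connected (V i) (r i)) ->
  (forall i, symmetric (r i)) -> (forall i, subrel (r i) e) ->
  (forall i j, i != j -> V i :&: V j \subset S) ->
  (forall i j u v, u \in S -> v \in S -> r i u v -> r j u v -> i = j) ->
  #|I| <= tree_connectivity e S.
Proof.
move=> [sym irr] S2 sSV cV rsym re dV dr.
pose E i := [set [set p.1; p.2] | p : T * T & [&& p.1 \in V i, p.2 \in V i & r i p.1 p.2]].
have EP i f : f \in E i ->
    exists u v, [/\ f = [set u; v], u \in V i, v \in V i & r i u v].
  by case/imsetP=> -[u v]; rewrite inE /= => /and3P[uV vV ruv] ->; exists u, v.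
have EV i f : f \in E i -> f \subset V i.
  by case/EP=> u [v [-> uV vV _]]; rewrite subUset !sub1set uV.
have [x [y [xS yS nxy]]] : exists x y, [/\ x \in S, y \in S & x != y].
  by have [x [y [xS yS nxy]]] := card_gt1P S2; exists x, y.
have cE i : connected (V i) (adj (V i, E i)).
  apply: connected_subrel (cV i) => u v uV vV ruv; rewrite /adj /=.
  by apply/imsetP; exists (u, v) => //; rewrite inE /= uV vV.
have V0 i : V i != set0 by apply/set0Pn; exists x; apply: (subsetP (sSV i)).
have /fin_all_exists2[E' sE' tE'] : forall i, exists2 E' : {set {set T}},
    E' \subset E i & is_tree (V i, E').
  by move=> i; apply: spanning_tree => // f; apply: EV.
have dE i j f : f \in E i -> f \in E j -> i = j.
  move=> /EP[u [v [-> uV vV ruv]]] /EP[u' [v' [Ef uV' vV' ruv']]].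
  apply/eqP; apply: contraT => nij.
  have fS : [set u; v] \subset S.
    apply: subset_trans (dV i j nij); rewrite subsetI; apply/andP; split.
      by rewrite subUset !sub1set uV.
    by rewrite Ef subUset !sub1set uV'.
  move: fS; rewrite subUset !sub1set => /andP[uS vS].
  have {}ruv' : r j u v.
    have : u \in [set u'; v'] by rewrite -Ef set21.
    have : v \in [set u'; v'] by rewrite -Ef set22.
    have nuv : u != v by apply: contraTneq (re _ _ _ ruv) => ->; rewrite irr.
    rewrite !inE => /orP[]/eqP Ev /orP[]/eqP Eu; move: nuv; rewrite Eu Ev ?eqxx // => _.
    by rewrite rsym.
  by rewrite (dr _ _ _ _ uS vS ruv ruv') eqxx in nij.
pose tr i : subgraph T := (V i, E' i).
(* A family is a set, so its trees must be distinct to be counted: each has an edge because [S] has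
   two vertices, and no edge occurs at two indices. *)
have tr_inj : injective tr.
  move=> i j [_ EE].
  have /and3P[_ ct _] := tE' i.
  have [||||u [v [_ _ _ uv]]] := connected_leaves (X := [set x]) (x := x) (y := y) ct.
  - exact: (subsetP (sSV i)).
  - exact: (subsetP (sSV i)).
  - exact: set11.
  - by rewrite inE eq_sym.
  by apply: (dE i j [set u; v]); [apply: (subsetP (sE' i))|apply: (subsetP (sE' j)); rewrite -EE].
rewrite -(card_imset _ tr_inj); apply: leq_bigmax_cond; apply/andP; split.
  apply/forall_inP => _ /imsetP[i _ ->]; rewrite /S_tree tE' sSV /= andbT.
  rewrite /is_subgraph /=; apply/andP; split; last first.
    by apply/forall_inP => f fE; apply: EV; apply: (subsetP (sE' i)).
  apply/subsetP => f /(subsetP (sE' i))/EP[u [v [-> _ _ ruv]]].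
  by apply/imsetP; exists (u, v) => //; rewrite inE /=; apply: re ruv.
apply/forall_inP => _ /imsetP[i _ ->]; apply/forall_inP => _ /imsetP[j _ ->].
apply/implyP => nij; have {}nij : i != j by apply: contra nij => /eqP->.
apply/andP; split; first by rewrite eqEsubset dV // subsetI !sSV.
apply/eqP/setP => f; rewrite !inE /=; apply/negP => /andP[fi fj].
by case/eqP: nij; apply: (dE i j f); [apply: (subsetP (sE' i))|apply: (subsetP (sE' j))].
Qed.

Lemma tree_connectivity_family (T : finType) (e : rel T) (S : {set T}) :
  exists2 F, internally_disjoint_S_trees e S F & #|F| = tree_connectivity e S.
Proof.
have [|F FP E] := @eq_bigmax_cond _ [pred F | internally_disjoint_S_trees e S F]
  (fun F => #|F|); last by exists F => //; rewrite -E; apply: eq_bigl.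
apply/card_gt0P; exists set0; rewrite inE /internally_disjoint_S_trees.
by apply/andP; split; apply/forall_inP => A; rewrite inE.
Qed.

(** If every tree has an edge at [x] other than [xy], these edges lead to distinct vertices among
    the [d] other neighbours of [x]; likewise at [y]. Otherwise one tree has only [xy] at [x], and
    one has only [xy] at [y]. Sharing [xy], they coincide, and this tree cannot reach [z]. *)
Lemma tree_connectivity_adjacent (T : finType) (e : rel T) (d : nat) (x y z : T) :
  simple_graph e -> regular e d.+1 -> e x y -> z != x -> z != y ->
  tree_connectivity e [set x; y; z] <= d.
Proof.
move=> [sym irr] reg exy nzx nzy; apply/bigmax_leqP => F /andP[/forall_inP tF /forall_inP dF].
have edge A u v : A \in F -> [set u; v] \in A.2 -> e u v.
  by case/tF/and3P=> /andP[/subsetP sE _] _ _ /sE; rewrite edges_pair.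
have disj A B f : A \in F -> B \in F -> f \in A.2 -> f \in B.2 -> A = B.
  move=> AF BF fA fB; apply/eqP; apply: contraT => nAB.
  have /forall_inP/(_ B BF)/implyP/(_ nAB)/andP[_ /eqP/setP/(_ f)] := dF A AF.
  by rewrite inE fA fB inE.
have bound a b : e a b ->
    (forall A, A \in F -> exists2 w, w != b & [set a; w] \in A.2) -> #|F| <= d.
  move=> eab ex.
  have /fin_all_exists[w wP] : forall A, exists w, A \in F -> w != b /\ [set a; w] \in A.2.
    move=> A; have [/ex[w nw aw]|nA] := boolP (A \in F); first by exists w.
    by exists b.
  have -> : d = #|[set w | e a w & w != b]|.
    have := reg a; rewrite (cardsD1 b) inE eab add1n => -[<-].
    by apply: eq_card => v; rewrite !inE andbC.
  rewrite -(card_in_imset (f := w)); last first.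
    move=> A B AF BF E; have [_ fA] := wP A AF; have [_ fB] := wP B BF.
    by apply: disj fA _ => //; rewrite E.
  apply/subset_leq_card/subsetP => _ /imsetP[A AF ->]; have [nw aw] := wP A AF.
  by rewrite inE (edge _ _ _ AF aw).
have conn A (X : {set T}) : A \in F -> X \subset [set x; y] -> X != set0 ->
    exists u v, [/\ u \in X, v \notin X & [set u; v] \in A.2].
  move=> AF sX /set0Pn[u uX]; have /and3P[_ /and3P[_ cA _] /subsetP sS] := tF A AF.
  have [||//||a [b [aX _ bX ab]]] := connected_leaves (X := X) (x := u) (y := z) cA.
  - by apply: sS; move: (subsetP sX u uX); rewrite !inE => ->.
  - by apply: sS; rewrite !inE eqxx orbT.
  - apply/negP => /(subsetP sX); rewrite !inE (negPf nzx) (negPf nzy) //.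
  by exists a, b.
have [/forall_inP ex|] := boolP [forall A in F, [exists w, (w != y) && ([set x; w] \in A.2)]].
  by apply: (bound x y exy) => A /ex/existsP[w /andP[]]; exists w.
have [/forall_inP ex _|] := boolP [forall A in F, [exists w, (w != x) && ([set y; w] \in A.2)]].
  by apply: (bound y x) => [|A /ex/existsP[w /andP[]]]; [rewrite sym|exists w].
rewrite !negb_forall_in => /exists_inP[B BF nB] /exists_inP[A AF nA].
have only (C : subgraph T) a b u : ~~ [exists w, (w != b) && ([set a; w] \in C.2)] ->
    [set a; u] \in C.2 -> u = b.
  by move=> nC au; apply/eqP; apply: contraNT nC => ub; apply/existsP; exists u; rewrite ub.
have single (C : subgraph T) a b : C \in F -> a \in [set x; y] ->
    ~~ [exists w, (w != b) && ([set a; w] \in C.2)] -> [set a; b] \in C.2.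
  move=> CF aS nC; have [||u [v [/set1P-> _ av]]] := conn C [set a] CF.
  - by rewrite sub1set.
  - by apply/set0Pn; exists a; apply: set11.
  by rewrite -(only _ _ _ _ nC av).
have xyA := single A x y AF (set21 _ _) nA.
have yxB := single B y x BF (set22 _ _) nB.
rewrite setUC in yxB; have EAB := disj _ _ _ AF BF xyA yxB; subst B.
have [|u [v [+ nv uv]]] := conn A [set x; y] AF (subxx _).
  by apply/set0Pn; exists x; apply: set21.
by move: nv uv; rewrite !inE negb_or => /andP[vx vy] uv /orP[]/eqP Eu; subst u;
  [have Ev := only _ _ _ _ nA uv|have Ev := only _ _ _ _ nB uv];
  rewrite Ev eqxx in vx vy.
Qed.

(** * Sums of clusters *)

Section ClusterSum.

Variables (d t : nat) (T : finType) (g : rel T) (h : rel ('I_t * T)).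
Hypotheses (d_gt0 : 0 < d) (t_ge : d + 3 <= t) (cT : #|T| = t).
Hypotheses (g_simple : simple_graph g) (g_reg : regular g d).
Hypotheses (g_conn : k_connected g d) (h_sum : cluster_sum d g h).

Variable out : 'I_t * T -> 'I_t * T.
Hypothesis outE : forall u v, cross h u v = (v == out u).

Let h_sym : symmetric h := (cluster_sum_simple h_sum).1.
Let h_irr : irreflexive h := (cluster_sum_simple h_sum).2.
Let h_copy i x y : h (i, x) (i, y) = g x y := cluster_sum_copy h_sum i x y.

Definition copy (i : 'I_t) (V : {set T}) : {set 'I_t * T} := pair i @: V.

Definition cluster (i : 'I_t) : {set 'I_t * T} := [set u | u.1 == i].

Lemma in_copy i V u : (u \in copy i V) = (u.1 == i) && (u.2 \in V).
Proof.
apply/imsetP/andP => [[a aV ->]|[/eqP Ei uV]]; first by rewrite /= eqxx.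
by exists u.2 => //; rewrite -Ei; case: u {Ei uV}.
Qed.

Lemma h_out u : h u (out u).
Proof. by have := outE u (out u); rewrite eqxx => /andP[]. Qed.

Lemma out_neq u : (out u).1 != u.1.
Proof. by have := outE u (out u); rewrite eqxx eq_sym => /andP[]. Qed.

Lemma outK : involutive out.
Proof.
move=> u; apply/esym/eqP; rewrite -outE /cross /= h_sym h_out.
exact: out_neq.
Qed.

Lemma out_onto i j : i != j -> exists a, (out (i, a)).1 = j.
Proof.
move=> nij; have /andP[/card_gt0P[[a b]]] := cluster_sum_between h_sum nij.
rewrite inE /= => hab _; exists a.
have /eqP<- // : (j, b) == out (i, a).
by rewrite -outE /cross /= hab.
Qed.

(* The t vertices of a cluster have out-neighbours in all of the t - 1 other
   clusters, so that at most one pair of them shares the cluster. *)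
Lemma out_inj i a b : a != b -> (out (i, a)).1 = (out (i, b)).1 ->
  {in [set~ a] &, injective (fun c => (out (i, c)).1)}.
Proof.
move=> nab E; apply/imset_injP; rewrite eqn_leq leq_imset_card cardsC1 cT /=.
have -> : t.-1 = #|[set~ i]| by rewrite cardsC1 card_ord.
apply/subset_leq_card/subsetP => j; rewrite !inE eq_sym => /out_onto[c <-].
have [->|nca] := eqVneq c a; first by rewrite E; apply: imset_f; rewrite !inE eq_sym.
by apply: imset_f; rewrite !inE.
Qed.

Lemma connected_cluster i (r : rel ('I_t * T)) :
  (forall a b, g a b -> r (i, a) (i, b)) -> connected (cluster i) r.
Proof.
move=> gr; have -> : cluster i = copy i [set: T].
  by apply/setP => u; rewrite in_copy !inE andbT.
apply: (connected_imset (e := g)) => [a b _ _|]; first exact: gr.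
by rewrite -setC0; apply: (k_connected_setC g_conn); rewrite cards0.
Qed.

(** Each cluster is connected, and any two clusters are joined by an edge. *)
Lemma connected_outside i (r : rel ('I_t * T)) :
  symmetric r -> (forall u v, u.1 != i -> v.1 != i -> h u v -> r u v) ->
  connected [set u | u.1 != i] r.
Proof.
move=> r_sym hr.
have cC j : j != i -> connected (cluster j) r.
  by move=> nj; apply: connected_cluster => a b gab; apply: hr; rewrite ?h_copy.
apply/connectedP => -[j a] [l b]; rewrite !inE /= => nji nli.
have [ljE|njl] := eqVneq j l.
  subst l; have /connectedP/(_ (j, a) (j, b)) := cC j nji.
  rewrite !inE eqxx => /(_ isT isT); apply: connect_within_sub => //.
  by apply/subsetP => u; rewrite !inE => /eqP->.
have [a' Ea'] := out_onto njl.
have /connectedP/(_ (j, a) (l, b)) : connected (cluster j :|: cluster l) r.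
  apply: (@connectedU _ _ _ _ (j, a') (out (j, a'))); rewrite ?cC ?inE ?Ea' ?eqxx //.
  by rewrite hr ?orbT ?h_out // Ea'.
rewrite !inE !eqxx orbT => /(_ isT isT); apply: connect_within_sub => //.
by apply/subsetP => u; rewrite !inE => /orP[]/eqP->.
Qed.

Lemma attach_copy i (H : {set 'I_t * T}) (Z : {set T}) (a : T) (r : rel ('I_t * T)) :
  symmetric r -> connected H r -> connected Z g ->
  {in Z &, forall a b, g a b -> r (i, a) (i, b)} ->
  a \in Z -> out (i, a) \in H -> r (i, a) (out (i, a)) ->
  connected (H :|: copy i Z) r.
Proof.
move=> r_sym cH cZ gr aZ oH ra.
apply: (@connectedU _ _ _ _ (out (i, a)) (i, a)) => //.
- exact: connected_imset cZ.
- by rewrite in_copy /= eqxx.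
by rewrite r_sym ra orbT.
Qed.

(** * Lower bound: [S] in one, three or two clusters *)

Lemma one_cluster i (S : {set 'I_t * T}) :
  gen_connectivity 3 g + 1 = d -> #|S| = 3 -> {in S, forall u, u.1 = i} ->
  d <= tree_connectivity h S.
Proof.
move=> kg cS Si; pose S' := [set a | (i, a) \in S].
have ES : S = copy i S'.
  apply/setP => u; rewrite in_copy inE; apply/idP/andP => [uS|[/eqP Eu]].
    by have Eu := Si u uS; rewrite -Eu eqxx; case: u uS {Eu}.
  by rewrite -Eu; case: u {Eu}.
have cS' : #|S'| = 3 by rewrite -cS ES card_imset // => a b [].
have le_g : d <= (tree_connectivity g S').+1.
  rewrite -kg addn1 ltnS; apply: (gen_connectivityP g _).2 => //.
  by rewrite cT; apply: leq_trans t_ge; rewrite leq_addl.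
have [F /andP[/forall_inP tF /forall_inP dF] cF] := tree_connectivity_family g S'.
rewrite -cF in le_g; apply: leq_trans le_g _.
pose A (m : 'I_#|F|) : subgraph T := enum_val m.
have AF m : A m \in F by apply: enum_valP.
have -> : #|F|.+1 = #|{: option 'I_#|F|}| by rewrite card_option card_ord.
(* [Some m] stands for the copy of the tree [A m] of a maximum family in [g], and [None] for the
   additional tree through the other clusters. *)
pose V (k : option 'I_#|F|) :=
  if k is Some m then copy i (A m).1 else S :|: [set u | u.1 != i].
(* The copied trees keep exactly their own edges, so inside [S] they are disjoint because the family
   is; the additional tree uses no edge inside [S]. *)
pose r (k : option 'I_#|F|) : rel ('I_t * T) := [rel u v | h u v &&
  if k is Some m then [&& u.1 == i, v.1 == i & [set u.2; v.2] \in (A m).2]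
  else ~~ ((u \in S) && (v \in S))].
have r_sym k : symmetric (r k).
  move=> u v; rewrite /r /= h_sym; case: k => [m|]; last by rewrite [X in ~~ X]andbC.
  by rewrite setUC [X in _ && X]andbCA.
apply: (@packing _ _ h S V r) => //.
- by rewrite cS.
- case=> [m|]; last exact: subsetUl.
  by have /and3P[_ _ sS] := tF _ (AF m); rewrite /V ES; apply: imsetS.
- case=> [m|].
    have /and3P[/andP[/subsetP sE _] /and3P[_ cA _] _] := tF _ (AF m).
    apply: connected_imset cA => a b _ _ ab; rewrite /r /= !eqxx /= h_copy.
    rewrite /adj /= in ab; rewrite ab andbT -(edges_pair _ _ g_simple.1).
    exact: sE.
  have cO : connected [set u | u.1 != i] (r None).
    apply: connected_outside => // u v nu nv huv; rewrite /r /= huv.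
    by apply/negP => /andP[/Si E _]; rewrite E eqxx in nu.
  have [u0 u0S] : exists u, u \in S by apply/card_gt0P; rewrite cS.
  have oO u : u \in S -> out u \in [set u | u.1 != i].
    by move=> uS; rewrite inE -(Si u uS) out_neq.
  have /connectedP cO' := cO.
  apply: (connected_from (x := out u0)) => // u.
  rewrite inE => /orP[uS|uO]; last first.
    by apply: connect_within_sub (cO' _ _ (oO _ u0S) uO); rewrite ?subsetUr.
  apply: (@connect_trans _ _ (out u)).
    by apply: connect_within_sub (cO' _ _ (oO _ u0S) (oO _ uS)); rewrite ?subsetUr.
  apply: connect1; rewrite /within /= !in_setU uS oO // orbT /r /= h_sym h_out /=.
  by apply/negP => /andP[/Si E _]; have := oO u uS; rewrite inE E eqxx.
- by case=> [m|] u v /andP[].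
- have dNS m : V None :&: V (Some m) \subset S.
    apply/subsetP => u; rewrite in_setI in_setU inE in_copy.
    by case/andP=> /orP[//|nu] /andP[/eqP Eu _]; rewrite Eu eqxx in nu.
  case=> [m|] [l|] // nml; last by rewrite setIC.
  have nA : A m != A l by apply: contra nml => /eqP/enum_val_inj->.
  have /forall_inP/(_ _ (AF l))/implyP/(_ nA)/andP[/eqP EA _] := dF _ (AF m).
  apply/subsetP => u /setIP[]; rewrite /= !in_copy ES in_copy => /andP[-> um] /andP[_ ul].
  by rewrite -EA inE um.
have dNS m u v : u \in S -> v \in S -> r None u v -> r (Some m) u v -> None = Some m.
  by move=> uS vS /andP[_]; rewrite uS vS.
case=> [m|] [l|] u v uS vS // ruv ruv'; [| exact/esym/(dNS m u v) | exact: (dNS l u v)].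
case/and4P: ruv => _ _ _ fm; case/and4P: ruv' => _ _ _ fl.
congr Some; apply: enum_val_inj; apply/eqP; apply: contraT => nA.
have /forall_inP/(_ _ (AF l))/implyP/(_ nA)/andP[_ /eqP/setP/(_ [set u.2; v.2])] := dF _ (AF m).
by rewrite inE fm fl inE.
Qed.

(** Exits towards distinct clusters are distinct vertices, hence admissible targets of a fan. *)
Lemma cluster_fan i z (c : 'I_d -> 'I_t) :
  injective c -> (forall k, c k != i) ->
  exists (Z : 'I_d -> {set T}) (a : 'I_d -> T),
    [/\ forall k, z \in Z k, forall k, a k \in Z k,
        forall k, (out (i, a k)).1 = c k, forall k, connected (Z k) g &
        forall k l, k != l -> Z k :&: Z l \subset [set z]].
Proof.
move=> c_inj ci.
have /fin_all_exists[a aE] : forall k, exists a, (out (i, a)).1 = c k.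
  by move=> k; apply: out_onto; rewrite eq_sym.
have a_inj : injective a by move=> k l E; apply: c_inj; rewrite -!aE E.
have [Z [zZ aZ cZ dZ]] := k_connected_fan z g_simple g_reg g_conn a_inj.
by exists Z, a.
Qed.

Lemma three_clusters i1 i2 i3 x1 x2 x3 : i1 != i2 -> i1 != i3 -> i2 != i3 ->
  d <= tree_connectivity h [set (i1, x1); (i2, x2); (i3, x3)].
Proof.
move=> n12 n13 n23; set S := [set _; _; _].
(* Here [d + 3 <= t] is essential: [d] hubs must remain besides the three clusters of [S]. *)
have cI : d <= #|~: [set i1; i2; i3]|.
  rewrite -(leq_add2l #|[set i1; i2; i3]|) cardsC card_ord addnC.
  by apply: leq_trans t_ge; rewrite leq_add2l setUC cardsU1 cards2 (@leq_add _ _ 1 2) ?leq_b1 // ltnS leq_b1.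
pose c (k : 'I_d) : 'I_t := enum_val (widen_ord cI k).
have c_inj : injective c.
  by move=> k l /enum_val_inj/(congr1 val) /= E; apply: val_inj.
have [c1 c2 c3] : [/\ forall k, c k != i1, forall k, c k != i2 & forall k, c k != i3].
  have cP k : c k \in ~: [set i1; i2; i3] by apply: enum_valP.
  by split=> k; have := cP k; rewrite !inE !negb_or -andbA => /and3P[].
have [X1 [a1 [xX1 aX1 oX1 cX1 dX1]]] := cluster_fan x1 c_inj c1.
have [X2 [a2 [xX2 aX2 oX2 cX2 dX2]]] := cluster_fan x2 c_inj c2.
have [X3 [a3 [xX3 aX3 oX3 cX3 dX3]]] := cluster_fan x3 c_inj c3.
(* One relation serves all trees: edges within a cluster never join two vertices of [S], and the
   exits used lead to hubs, which do not meet [S]. *)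
pose r : rel ('I_t * T) := [rel u v | h u v && ~~ ((u \in S) && (v \in S))].
have r_sym : symmetric r by move=> u v; rewrite /r /= h_sym [X in ~~ X]andbC.
pose V k := cluster (c k) :|: copy i1 (X1 k) :|: copy i2 (X2 k) :|: copy i3 (X3 k).
have S1 i a b : (i, a) \in S -> (i, b) \in S -> a = b.
  rewrite !inE !xpair_eqE => /orP[/orP[]|] /andP[/eqP-> /eqP->];
    case/orP=> [/orP[]|] /andP[/eqP E /eqP->] //;
    by move: n12 n13 n23; rewrite ?E -?E ?eqxx.
have gr i a b : g a b -> r (i, a) (i, b).
  move=> gab; rewrite /r /= h_copy gab; apply/negP => /andP[aS bS].
  by rewrite (S1 i a b aS bS) g_simple.2 in gab.
have ro k i a : (out (i, a)).1 = c k -> r (i, a) (out (i, a)).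
  move=> E; rewrite /r /= h_out; apply/negP => /andP[_].
  rewrite (surjective_pairing (out _)) E !inE !xpair_eqE.
  by rewrite (negPf (c1 k)) (negPf (c2 k)) (negPf (c3 k)).
rewrite -[d]card_ord; apply: (@packing _ _ h S V (fun _ => r)) => //.
- by rewrite /S setUC cardsU1 cards2 !inE !xpair_eqE ![i3 == _]eq_sym (negPf n12) (negPf n13) (negPf n23).
- move=> k; rewrite /S !subUset !sub1set !in_setU !in_copy /= !eqxx.
  by rewrite xX1 xX2 xX3 /= ?orbT.
- move=> k.
  apply: (attach_copy (a := a3 k)) => //; last 2 first.
  + by rewrite !in_setU inE oX3 eqxx.
  + exact: (ro k).
  + apply: (attach_copy (a := a2 k)) => //; last 2 first.
    * by rewrite !in_setU inE oX2 eqxx.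
    * exact: (ro k).
    * apply: (attach_copy (a := a1 k)) => //; last 2 first.
      -- by rewrite inE oX1.
      -- exact: (ro k).
      -- by apply: connected_cluster => a b; apply: gr.
      -- by move=> a b _ _; apply: gr.
    * by move=> a b _ _; apply: gr.
  + by move=> a b _ _; apply: gr.
- by move=> k u v /andP[].
- move=> k l nkl; apply/subsetP => -[j b].
  have VE m : (j, b) \in V m = [|| j == c m, (j == i1) && (b \in X1 m),
      (j == i2) && (b \in X2 m) | (j == i3) && (b \in X3 m)].
    by rewrite !in_setU !in_copy inE /= !orbA.
  rewrite in_setI !VE {VE}.
  have [->|n1] := eqVneq j i1.
    rewrite ![i1 == c _]eq_sym !(negPf (c1 _)) (negPf n12) (negPf n13) /= !orbF.
    by rewrite -in_setI => /(subsetP (dX1 k l nkl))/set1P->; rewrite !inE eqxx.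
  have [->|n2] := eqVneq j i2.
    rewrite ![i2 == c _]eq_sym !(negPf (c2 _)) (negPf n23) /= !orbF.
    by rewrite -in_setI => /(subsetP (dX2 k l nkl))/set1P->; rewrite !inE eqxx orbT.
  have [->|n3] := eqVneq j i3.
    rewrite ![i3 == c _]eq_sym !(negPf (c3 _)) /=.
    by rewrite -in_setI => /(subsetP (dX3 k l nkl))/set1P->; rewrite !inE eqxx !orbT.
  rewrite !orbF => /andP[/eqP-> /eqP/c_inj E].
  by rewrite E eqxx in nkl.
move=> k l u v uS vS /andP[_]; by rewrite uS vS.
Qed.

(* One vertex of each W k: x for the path of index k0 and an inner vertex for
   each of the others; if two of these have out-neighbours in the same cluster,
   one of them is exchanged for y. *)
Lemma distinct_exits i x y (k0 : 'I_d) (W : 'I_d -> {set T}) :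
  x != y -> (forall k, x \in W k) -> (forall k, y \in W k) ->
  (forall k, k != k0 -> exists2 w, w \in W k & w \notin [set x; y]) ->
  (forall k l, k != l -> W k :&: W l \subset [set x; y]) ->
  exists2 v : 'I_d -> T, forall k, v k \in W k &
    injective (fun k => (out (i, v k)).1).
Proof.
move=> nxy xW yW inner dW.
have /fin_all_exists[w wP] : forall k, exists w,
    k != k0 -> w \in W k /\ w \notin [set x; y].
  by move=> k; case: (boolP (k != k0)) => [/inner[w]|_]; [exists w | exists x].
pose v k := if k == k0 then x else w k.
have vW k : v k \in W k by rewrite /v; case: ifPn => // /wP[].
have vy k : v k != y.
  rewrite /v; case: ifPn => // /wP[_]; by rewrite !inE negb_or => /andP[].
have v_inj : injective v.
  move=> k l E; apply/eqP; apply: contraT => nkl.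
  have : v k \in [set x; y] by apply: (subsetP (dW k l nkl)); rewrite inE vW E vW.
  have nx m : m != k0 -> v m \notin [set x; y].
    by move=> nm; rewrite /v (negPf nm); case: (wP m nm).
  have [Ek|/nx/negPf->//] := eqVneq k k0.
  by rewrite E (negPf (nx l _)) // -Ek eq_sym.
have [/injectiveP cl_inj|] := boolP (injectiveb (fun k => (out (i, v k)).1)).
  by exists v.
case/injectivePn=> k [l nkl E]; exists (fun m => if m == k then y else v m).
  by move=> m; case: eqP => [->|_].
(* Since [v k] and [v l] already share a cluster, exits are injective away from [v k]. The new
   choice avoids [v k], and [y] differs from all the other chosen vertices. *)
have nv : v k != v l by apply: contra nkl => /eqP/v_inj->.
have cl_inj := out_inj nv E.
move=> m n /cl_inj En.
have nk p : (if p == k then y else v p) \in [set~ v k].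
  rewrite !inE; case: (eqVneq p k) => [_|npk]; first by rewrite eq_sym.
  by apply: contra npk => /eqP/v_inj->.
move: (En (nk m) (nk n)).
case: eqP => [->|nm]; case: eqP => [->|nn] //.
- by move=> Ey; have := vy n; rewrite -Ey eqxx.
- by move=> Ey; have := vy m; rewrite Ey eqxx.
exact: v_inj.
Qed.

Lemma two_clusters i1 i2 x y z : i1 != i2 -> x != y ->
  d <= tree_connectivity h [set (i1, x); (i1, y); (i2, z)].
Proof.
move=> n12 nxy; set S := [set _; _; _].
have [W [k0 [xW yW cW dW]]] := k_connected_paths g_simple g_reg g_conn d_gt0 nxy.
have [v vW c_inj] : exists2 v : 'I_d -> T, forall k, v k \in W k &
    injective (fun k => (out (i1, v k)).1).
  apply: (distinct_exits (k0 := k0) i1 nxy xW yW) dW => k nk.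
  (* For [k != k0] the first step from [x] towards [y] inside [W k] cannot be the edge [xy], so it
     reaches an inner vertex. *)
  have [||||u [w [/set1P-> wW _]]] :=
    connected_leaves (X := [set x]) (x := x) (y := y) (cW k) => //.
  - exact: set11.
  - by rewrite inE eq_sym.
  by rewrite /= (negPf nk) set21 => /andP[_ nw]; exists w.
pose c k := (out (i1, v k)).1.
have c1 k : c k != i1 by apply: out_neq.
have /fin_all_exists[w wP] : forall k, exists a,
    if c k == i2 then (i2, a) = out (i1, v k) else (out (i2, a)).1 = c k.
  move=> k; case: eqVneq => [Ek|nk]; last by apply: out_onto; rewrite eq_sym.
  by exists (out (i1, v k)).2; rewrite -Ek [RHS]surjective_pairing.
(* The cluster of the out-neighbour of [w k] determines [c k]: it is [c k] itself, or [i1] when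
   [c k] is [i2], and no [c k] equals [i1]. *)
have w_inj : injective w.
  have ow k : (out (i2, w k)).1 = if c k == i2 then i1 else c k.
    by have := wP k; case: eqP => // _ ->; rewrite outK.
  move=> k l E; apply: c_inj; have := ow k; rewrite E ow -/(c k) -/(c l).
  case: eqP => [->|_]; case: eqP => [->|_] // Ec.
    by have := c1 k; rewrite -Ec eqxx.
  by have := c1 l; rewrite Ec eqxx.
have [Z [zZ wZ cZ dZ]] := k_connected_fan z g_simple g_reg g_conn w_inj.
(* Edges inside S may be needed: {x, y} by the path of index k0, and the edge
   from x or y to z by the path leaving for the cluster of z. *)
pose r (k : 'I_d) : rel ('I_t * T) := [rel u v | h u v &&
  [|| ~~ ((u \in S) && (v \in S)), (u.1 == v.1) && (k == k0) |
      (u.1 != v.1) && (c k == i2)]].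
have r_sym k : symmetric (r k).
  by move=> a b; rewrite /r /= h_sym [a.1 == _]eq_sym [X in ~~ X]andbC.
pose core k := if c k == i2 then copy i1 (W k) else cluster (c k) :|: copy i1 (W k).
pose V k := core k :|: copy i2 (Z k).
have inS1 a : ((i1, a) \in S) = (a \in [set x; y]).
  by rewrite !inE !xpair_eqE eqxx (negPf n12) orbF.
have inS2 a : ((i2, a) \in S) = (a == z).
  by rewrite !inE !xpair_eqE eqxx eq_sym (negPf n12).
have cW' k : connected (copy i1 (W k)) (r k).
  apply: connected_imset (cW k) => a b _ _ /andP[gab ab].
  by rewrite /r /= h_copy gab !inS1 eqxx /= orbF orbC.
have notS a k : c k != i2 -> a.1 = c k -> a \notin S.
  move=> nk; case: a => _ a /= ->.
  by rewrite !inE !xpair_eqE (negPf (c1 k)) (negPf nk).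
rewrite -[d]card_ord; apply: (@packing _ _ h S V r) => //.
- by rewrite /S setUC cardsU1 cards2 !inE !xpair_eqE ![i2 == _]eq_sym (negPf n12) eqxx nxy.
- move=> k; rewrite /S !subUset !sub1set !in_setU !in_copy /= !eqxx zZ orbT andbT.
  by rewrite /core; case: ifP => _; rewrite ?in_setU !in_copy /= eqxx xW yW ?orbT.
- move=> k; have := wP k; rewrite /V /core; case: eqVneq => [Ek Ew|nk ow].
    have Eo : out (i2, w k) = (i1, v k) by rewrite Ew outK.
    apply: (attach_copy (a := w k)) => //; rewrite ?Eo.
    + move=> a b _ _ gab; rewrite /r /= h_copy gab !inS2.
      by case: eqP gab => [->|//]; case: eqP => // ->; rewrite g_simple.2.
    + by rewrite in_copy /= eqxx vW.
    by rewrite /r /= -Eo h_out Eo /= Ek eqxx eq_sym n12 !orbT.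
  apply: (attach_copy (a := w k)) => //.
  + apply: (@connectedU _ _ _ _ (out (i1, v k)) (i1, v k)) => //.
    * apply: connected_cluster => a b gab; rewrite /r /= h_copy gab.
      by rewrite (negPf (notS (c k, a) k nk _)).
    * by rewrite inE.
    * by rewrite in_copy /= eqxx vW.
    by rewrite /r /= h_sym h_out (negPf (notS (out _) k nk _)) ?orbT.
  + move=> a b _ _ gab; rewrite /r /= h_copy gab !inS2.
    by case: eqP gab => [->|//]; case: eqP => // ->; rewrite g_simple.2.
  + by rewrite in_setU inE ow eqxx.
  by rewrite /r /= h_out (negPf (notS (out _) k nk ow)) andbF.
- by move=> k a b /andP[].
- move=> k l nkl; apply/subsetP => -[j b].
  have VE m : (j, b) \in V m = [|| (j == c m) && (c m != i2),
      (j == i1) && (b \in W m) | (j == i2) && (b \in Z m)].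
    rewrite /V /core; case: eqP => _; rewrite !in_setU !in_copy ?inE /=.
      by rewrite andbF.
    by rewrite andbT orbA.
  rewrite in_setI !VE {VE}.
  have [->|n1] := eqVneq j i1.
    rewrite ![i1 == c _]eq_sym !(negPf (c1 _)) (negPf n12) /= !orbF.
    by rewrite -in_setI inS1 => /(subsetP (dW k l nkl)).
  have [->|n2] := eqVneq j i2.
    have nc m : (i2 == c m) && (c m != i2) = false by rewrite eq_sym andbN.
    rewrite !nc /= -in_setI inS2 => /(subsetP (dZ k l nkl)).
    by rewrite inE.
  rewrite !orbF => /andP[/andP[/eqP-> _] /andP[/eqP/c_inj E _]].
  by rewrite E eqxx in nkl.
(* An edge inside [S] belongs to index [k0] if it stays in a cluster, and otherwise to the index
   leaving for [i2], unique since [c] is injective. *)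
move=> k l a b aS bS /andP[_ +] /andP[_ +]; rewrite aS bS /=.
case: (a.1 == b.1) => /=; rewrite ?orbF => /eqP Ek /eqP El; first by rewrite Ek El.
by apply: c_inj; rewrite -/(c k) -/(c l) Ek El.
Qed.

Lemma cluster_sum_lower : gen_connectivity 3 g + 1 = d ->
  d <= gen_connectivity 3 h.
Proof.
move=> kg; have c3 : 3 <= #|{: 'I_t * T}|.
  rewrite card_prod card_ord cT; apply: leq_trans (leq_addl d 3) (leq_trans t_ge _).
  by rewrite leq_pmull // (leq_trans _ t_ge) // addnC.
have [[S cS ->] _] := gen_connectivityP h c3.
have [u uS] : exists u, u \in S by apply/card_gt0P; rewrite cS.
have /cards2P[v [w [nvw ES]]] : #|S :\ u| == 2.
  by have := cardsD1 u S; rewrite cS uS add1n => -[<-].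
have {ES} [nuv nuw ES] : [/\ u != v, u != w & S = [set u; v; w]].
  split; last by rewrite -(setD1K uS) ES setUA.
    have : v \in S :\ u by rewrite ES set21.
    by rewrite !inE eq_sym => /andP[].
  have : w \in S :\ u by rewrite ES set22.
  by rewrite !inE eq_sym => /andP[].
have [/forall_inP one|] := boolP [forall s in S, s.1 == u.1].
  by apply: (one_cluster kg cS (i := u.1)) => s /one/eqP.
rewrite ES => nall {uS cS}.
case: u v w nuv nuw nvw nall {ES} => [i x] [j y] [k z].
rewrite !xpair_eqE => nuv nuw nvw nall.
have [Eij|nij] := eqVneq i j; last first.
  (* When two vertices share a cluster, the triple is reordered to list them first. *)
  have [Eik|nik] := eqVneq i k.
    subst k; rewrite eqxx in nuw; rewrite -setUA [X in _ :|: X]setUC setUA.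
    exact: two_clusters.
  have [Ejk|njk] := eqVneq j k; last exact: three_clusters.
  subst k; rewrite eqxx in nvw; rewrite -setUA setUC.
  by apply: two_clusters; rewrite // eq_sym.
subst j; rewrite eqxx in nuv; apply: two_clusters => //.
apply: contra nall => /eqP E; apply/forall_inP => s.
by rewrite !inE => /orP[/orP[]|] /eqP-> //=; rewrite E.
Qed.

Lemma cluster_sum_upper : gen_connectivity 3 h <= d.
Proof.
have t_gt0 : 0 < t by apply: leq_trans t_ge; rewrite addnC.
have /card_gt0P[a _] : 0 < #|T| by rewrite cT.
pose u : 'I_t * T := (Ordinal t_gt0, a).
(* Any edge serves for the upper bound; [u] and its out-neighbour provide one, and a third vertex
   completes the triple. *)
have [|z _ nz] := @set_exists_notin _ [set: 'I_t * T] [set u; out u].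
  have c3 : 3 <= #|{: 'I_t * T}|.
    rewrite card_prod card_ord cT; apply: leq_trans (leq_addl d 3) (leq_trans t_ge _).
    by rewrite leq_pmull.
  by rewrite cardsT; apply: leq_trans c3; rewrite cards2 !ltnS leq_b1.
move: nz; rewrite !inE negb_or => /andP[nzu nzv].
have nuv : u != out u by apply: contraTneq (out_neq u) => <-; rewrite eqxx.
have c3 : #|[set u; out u; z]| = 3.
  by rewrite setUC cardsU1 cards2 !inE (negPf nzu) (negPf nzv) nuv.
apply: leq_trans ((gen_connectivityP h _).2 _ c3) _.
  by rewrite -c3; apply: max_card.
apply: tree_connectivity_adjacent => //; last exact: h_out.
exact: cluster_sum_regular h_sum.
Qed.

End ClusterSum.

Theorem theorem1 (d t : nat) (T : finType) (g : rel T) (h : rel ('I_t * T)) :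
  d + 3 <= t ->
  simple_graph g ->
  #|T| = t ->
  regular g d ->
  k_connected g d ->
  gen_connectivity 3 g + 1 = d ->
  cluster_sum d g h ->
  gen_connectivity 3 h = d.
Proof.
move=> t_ge g_simple cT g_reg g_conn kg h_sum.
(* Stating the value [d - 1] as a sum avoids truncated subtraction and makes [d] positive. *)
have d_gt0 : 0 < d by rewrite -kg addn1.
have /fin_all_exists[out outE] : forall u, exists o, forall v, cross h u v = (v == o).
  move=> u; have /eqP/cards1P[o Eo] := cluster_sum_out h_sum u.
  by exists o => v; have /setP/(_ v) := Eo; rewrite !inE.
apply/eqP; rewrite eqn_leq.
by rewrite (cluster_sum_upper t_ge cT h_sum outE) (cluster_sum_lower _ _ _ _ _ _ h_sum outE).
Qed.
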